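(* Let $H$ be a real Hilbert space, $F:H\to H$ a monotone operator, i.e. $(F(u)-F(v),u-v)\ge 0$ for all $u,v\in H$, and let $u_0\in H$, $R>0$, $B(u_0,R):=\{u\in H:\|u-u_0\|\le R\}$. Assume that $F$ has Fréchet derivatives $F',F''$ on $B(u_0,R)$ with $\sup_{u\in B(u_0,R)}\|F^{(j)}(u)\|\le M_j<\infty$, $j=1,2$, that $F$ is locally Lipschitz on $H$, and that $F(u)=0$ has a solution in $B(u_0,R)$; let $y$ be the minimal-norm solution of $F(u)=0$. For a constant $\epsilon>0$ let $u(t)=u(t;\epsilon)$ solve $$\dot u=-F(u)-\epsilon u,\qquad u(0)=u_0,$$ and let $t_\epsilon>0$ be any number (depending on $\epsilon$) such that $\lim_{\epsilon\to0}\epsilon t_\epsilon=\infty$. Then $$\lim_{\epsilon\to0}\|u(t_\epsilon)-y\|=0.$$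
   Context: $(\cdot,\cdot)$ and $\|\cdot\|$ are the inner product and norm of $H$; $\dot u=du/dt$. *)

(* Defs.v *)
From mathcomp Require Import all_boot all_order all_algebra.
From mathcomp Require Import sesquilinear.
From mathcomp Require Import all_classical all_reals all_analysis.

Set Implicit Arguments.
Unset Strict Implicit.
Unset Printing Implicit Defensive.

Import Order.TTheory GRing.Theory Num.Theory.
Import numFieldNormedType.Exports.

Local Open Scope classical_set_scope.
Local Open Scope ring_scope.

(* A real Hilbert space is a complete normed module over [R] together with a
   symmetric positive definite bilinear form that induces its norm. *)
Definition induces_norm (R : realType) (H : completeNormedModType R)
    (dot : {dot H for idfun}) : Prop :=
  forall v : H, `|v| = Num.sqrt (dot v v).

Definition cball (R : realType) (H : normedModType R) (c : H) (r : R) : set H :=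
  [set v | `|v - c| <= r].

Definition monotone_operator (R : realType) (H : completeNormedModType R)
    (dot : {dot H for idfun}) (F : H -> H) : Prop :=
  forall v w : H, 0 <= dot (F v - F w) (v - w).

Definition locally_lipschitz (R : realType) (H : normedModType R) (F : H -> H) :
    Prop :=
  forall v : H, exists2 rho : R, 0 < rho & [lipschitz F w | w in ball v rho].

Definition minimal_norm_zero (R : realType) (H : normedModType R) (F : H -> H)
    (y : H) : Prop :=
  F y = 0 /\ forall z : H, F z = 0 -> `|y| <= `|z|.

(* Norm of [A] in L(H, H), possibly +oo. *)
Definition opnorm (R : realType) (H : normedModType R) (A : H -> H) : \bar R :=
  ereal_sup [set `|A h|%:E | h in cball 0 1].

(* Norm of [A] in L(H, L(H, H)), where [A h] is the operator [k |-> A h k]. *)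
Definition opnorm2 (R : realType) (H : normedModType R) (A : H -> H -> H) :
    \bar R :=
  ereal_sup [set opnorm (A h) | h in cball 0 1].

(* [A] is the second Fréchet derivative of [F] at [v]: the derivative at [v], in
   the operator norm, of [w |-> 'd F w].  As ['d F w] is meaningful only where [F]
   is differentiable, the increments [w - v] are restricted to [w] in [D]. *)
Definition is_diff2_within (R : realType) (H : normedModType R) (D : set H)
    (F : H -> H) (v : H) (A : {bilinear H -> H -> H}) : Prop :=
  (opnorm2 A < +oo)%E /\
  forall e : R, 0 < e -> \forall w \near v, D w ->
    (opnorm (fun k : H => 'd F w k - 'd F v k - A (w - v) k)%R
      <= (e * `|w - v|)%:E)%E.

(* Solutions on [0, +oo[; the values of [u] at negative times are irrelevant, so at
   t = 0 only continuity from the right is required. *)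
Definition solves_cauchy (R : realType) (H : completeNormedModType R)
    (G : H -> H) (u0 : H) (u : R -> H) : Prop :=
  [/\ u 0 = u0,
      {within `[0, +oo[, continuous u} &
      forall t : R, 0 < t -> is_derive t (1 : R) u (G (u t))].

(* Main.v *)
Require Import Defs.
From mathcomp Require Import all_boot all_order all_algebra.
From mathcomp Require Import sesquilinear.
From mathcomp Require Import all_classical all_reals all_analysis.
From mathcomp Require Import ring lra.

Set Implicit Arguments.
Unset Strict Implicit.
Unset Printing Implicit Defensive.

Import Order.TTheory GRing.Theory Num.Theory.
Import numFieldNormedType.Exports.

Local Open Scope classical_set_scope.
Local Open Scope ring_scope.

(** The regularized flow u' = - F u - eps u contracts: monotonicity of F makes
    the distance of two solutions decay like exp (- eps t).  Comparing a solution
    with its own time translates (solution_translate), one sees that it and its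
    velocity converge exponentially, so that it tends to a zero V_eps of
    F + eps (solution_equilibrium).  Hence, by contraction again,
    |u(t) - V_eps| <= exp (- eps t) |u0 - V_eps|, which vanishes along t = t_eps
    because eps t_eps tends to infinity and |V_eps| <= |y|.

    It remains that V_eps tends to y.  Monotonicity applied to V_eps and V_delta
    shows that |V_eps| increases as eps decreases and that, for eps <= delta,
    |V_eps - V_delta|^2 <= |V_eps|^2 - |V_delta|^2 (regularized_gap).  As these
    norms are bounded by |y|, the family is Cauchy in the strong topology; its
    limit is a zero z of F, with |z| >= |y| since y has minimal norm, so |V_eps|
    tends to |y|.  Finally |V_eps - y|^2 <= |y|^2 - |V_eps|^2
    (regularized_norm_gap). *)

(** * Derivatives along the real line *)

Section RealLineDerivative.
Variable R : realType.

Lemma is_derive_cvg (V : normedModType R) (w : R -> V) (t : R) (w' : V) :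
  is_derive t (1 : R) w w' <->
  h^-1 *: (w (h + t) - w t) @[h --> 0^'] --> w'.
Proof.
have E : (fun h : R => h^-1 *: ((w \o shift t) (h *: (1 : R)) - w t)) =
         (fun h => h^-1 *: (w (h + t) - w t)).
  by apply/funext => h /=; rewrite /GRing.scale/= mulr1.
split=> [[dw <-]|cw].
  by rewrite /derive -E; exact: dw.
apply: DeriveDef; first by rewrite /derivable E; apply: cvgP cw.
by rewrite /derive E; apply/cvg_lim.
Qed.

Lemma is_derive_continuous (V : normedModType R) (w : R -> V) (t : R) (w' : V) :
  is_derive t (1 : R) w w' -> {for t, continuous w}.
Proof.
by move=> [dw _]; apply/differentiable_continuous/derivable1_diffP.
Qed.

Lemma is_derive_scalar_comp (f g : R -> R) (x df dg : R) :
  is_derive x (1 : R) f df -> is_derive (f x) (1 : R) g dg ->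
  is_derive x (1 : R) (g \o f) (dg * df).
Proof.
move=> [ef <-] [eg <-]; apply: DeriveDef.
  apply/derivable1_diffP; move/derivable1_diffP in ef.
  by move/derivable1_diffP in eg; exact: differentiable_comp ef eg.
rewrite -derive1E (derive1_comp ef eg) !derive1E; exact: erefl.
Qed.

Lemma is_derive_expRM (c t : R) :
  is_derive t (1 : R) (fun s => expR (c * s)) (expR (c * t) * c).
Proof.
have dl : is_derive t (1 : R) ( *%R c) c.
  by have := is_deriveZ c (is_derive_id t (1 : R)); rewrite /GRing.scale/= mulr1.
exact: is_derive_scalar_comp dl (is_derive_expR (c * t)).
Qed.

End RealLineDerivative.

(** * Squared norm and energy decay *)

Section InnerProduct.
Variables (R : realType) (H : completeNormedModType R).
Variables (dot : {dot H for idfun}) (dotH : induces_norm dot).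

Lemma dot_normsq (v : H) : dot v v = `|v| ^+ 2.
Proof.
rewrite dotH sqr_sqrtr//; have [->|v0] := eqVneq v 0; first by rewrite linear0r.
by rewrite ltW// neq0_dnorm_gt0.
Qed.

Lemma dotC (v w : H) : dot v w = dot w v.
Proof. by rewrite hermC expr0 mul1r. Qed.

Lemma normsqD (v w : H) : `|v + w| ^+ 2 = `|v| ^+ 2 + dot v w *+ 2 + `|w| ^+ 2.
Proof.
by rewrite -!dot_normsq linearDl !linearDr/= (dotC w v) mulr2n !addrA.
Qed.

Lemma normsqB (v w : H) : `|v - w| ^+ 2 = `|v| ^+ 2 - dot v w *+ 2 + `|w| ^+ 2.
Proof. by rewrite normsqD linearNr mulNrn normrN. Qed.

(** Polarization reduces continuity of the inner product to that of the norm. *)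
Lemma dot_polar (v w : H) : dot v w = 4^-1 * (`|v + w| ^+ 2 - `|v - w| ^+ 2).
Proof. rewrite normsqB normsqD; lra. Qed.

Lemma cvg_dot (T : Type) (G : set_system T) {FG : Filter G} (f g : T -> H)
    (a b : H) :
  f @ G --> a -> g @ G --> b -> dot (f x) (g x) @[x --> G] --> dot a b.
Proof.
move=> fa gb; rewrite dot_polar; under eq_fun do rewrite dot_polar.
apply: cvgM; first exact: cvg_cst.
apply: cvgB; rewrite expr2; under eq_fun do rewrite expr2.
  by apply: cvgM; apply: cvg_norm; exact: cvgD.
by apply: cvgM; apply: cvg_norm; exact: cvgB.
Qed.

(** The difference quotient of |w|^2 is the inner product of the difference
    quotient of w with w (h + t) + w t. *)
Lemma is_derive_normsq (w : R -> H) (t : R) (w' : H) :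
  is_derive t (1 : R) w w' ->
  is_derive t (1 : R) (fun s => `|w s| ^+ 2) (dot w' (w t) *+ 2).
Proof.
move=> dw; apply/is_derive_cvg.
have -> : (fun h : R => h^-1 *: (`|w (h + t)| ^+ 2 - `|w t| ^+ 2)) =
    (fun h => dot (h^-1 *: (w (h + t) - w t)) (w (h + t) + w t)).
  apply/funext => h; rewrite linearZl_LR/= -!dot_normsq.
  rewrite linearBl !linearDr/= (dotC (w t) (w (h + t))) /GRing.scale/=; ring.
have -> : dot w' (w t) *+ 2 = dot w' (w t + w t) by rewrite linearDr/= mulr2n.
apply: cvg_dot; first exact/is_derive_cvg.
apply: cvgD; last exact: cvg_cst.
have sh : h + t @[h --> (0 : R)^'] --> t.
  rewrite -[X in _ --> X]add0r; apply: cvgD; last exact: cvg_cst.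
  exact: nbhs_dnbhs.
exact: cvg_comp sh (is_derive_continuous dw).
Qed.

(** Grönwall's argument: exp (2 eps s) |w s|^2 is nonincreasing. *)
Lemma dissipative_decay (w : R -> H) (eps a b : R) : a <= b ->
  {within `[a, b], continuous w} ->
  (forall t, t \in `]a, b[ -> exists2 w', is_derive t (1 : R) w w' &
     dot w' (w t) <= - eps * `|w t| ^+ 2) ->
  `|w b| <= expR (- eps * (b - a)) * `|w a|.
Proof.
move=> ab cw dw.
pose phi s := expR (eps *+ 2 * s) * `|w s| ^+ 2.
have dphi t : t \in `]a, b[ -> exists2 p, is_derive t (1 : R) phi p & p <= 0.
  move=> /dw[w' dw' le]; eexists.
    exact: is_deriveM (is_derive_expRM _ _) (is_derive_normsq dw').
  rewrite /GRing.scale/= [X in _ + X]mulrC -mulrA -mulrDr.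
  rewrite pmulr_rle0 ?expR_gt0//; lra.
have phile : phi b <= phi a.
  apply: (@ler0_derive1_le_cc R phi a b); rewrite ?in_itv/= ?lexx ?ab//.
  - by move=> x /dphi[p [? _] _].
  - by move=> x /dphi[p dp p0]; rewrite derive1E derive_val.
  - have ce : {within `[a, b], continuous (fun s => expR (eps *+ 2 * s))}.
      apply: continuous_subspaceT => z.
      exact: is_derive_continuous (is_derive_expRM _ z).
    have cn : {within `[a, b], continuous (fun s => `|w s|)}.
      by move=> x; exact: cvg_norm (cw x).
    by move=> x; exact: cvgM (ce x) (cvgM (cn x) (cn x)).
rewrite -(@ler_pXn2r _ 2)// ?nnegrE ?mulr_ge0 ?expR_ge0//.
rewrite exprMn -expRM_natl -(@ler_pM2l _ (expR (eps *+ 2 * b))) ?expR_gt0//.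
rewrite [leRHS]mulrA -expRD; apply: le_trans phile _.
by rewrite /phi le_eqVlt; apply/orP; left; apply/eqP; congr (expR _ * _); ring.
Qed.

End InnerProduct.

(** * Contraction of the regularized flow *)

Section RegularizedFlow.
Variables (R : realType) (H : completeNormedModType R).
Variables (dot : {dot H for idfun}) (dotH : induces_norm dot).
Variables (F : H -> H) (monoF : monotone_operator dot F).

Lemma locally_lipschitz_continuous : locally_lipschitz F -> continuous F.
Proof.
move=> lipF v; have [rho rho0] := lipF v.
rewrite /lipschitz_on => -[M [_ /(_ (`|M| + 1))]].
rewrite (le_lt_trans (ler_norm M)) ?ltrDl// => /(_ isT) lip.
set k := `|M| + 1 in lip; have k0 : 0 < k by rewrite ltr_wpDl.
apply/cvgrPdist_le => e e0; near=> w.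
apply: (@le_trans _ _ (k * `|v - w|)).
  apply: (lip (v, w)); split => /=; first exact: ballxx.
  by near: w; exact: nbhsx_ballx.
rewrite -ler_pdivlMl// mulrC; near: w.
by apply: cvgr_dist_le; [exact: cvg_id|rewrite divr_gt0].
Unshelve. all: by end_near. Qed.

Section FixedParameter.
Variable eps : R.
Hypothesis eps_gt0 : 0 < eps.
Let G v := - F v - eps *: v.

(** Monotonicity of F makes F + eps strongly monotone with constant eps. *)
Lemma regularized_dissipative (v w : H) :
  dot (G v - G w) (v - w) <= - eps * `|v - w| ^+ 2.
Proof.
have -> : G v - G w = - (F v - F w) + (- eps) *: (v - w).
  rewrite /G scalerBr !scaleNr !opprD !opprK !addrA; congr (_ + _).
  by rewrite -!addrA; congr (_ + _); rewrite addrC.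
rewrite linearDl linearNl linearZl_LR/= dot_normsq// gerDr.
by rewrite oppr_le0 monoF.
Qed.

Lemma flow_contraction (v w : R -> H) (a b : R) : a <= b ->
  {within `[a, b], continuous v} -> {within `[a, b], continuous w} ->
  (forall t, t \in `]a, b[ -> is_derive t (1 : R) v (G (v t))) ->
  (forall t, t \in `]a, b[ -> is_derive t (1 : R) w (G (w t))) ->
  `|v b - w b| <= expR (- eps * (b - a)) * `|v a - w a|.
Proof.
move=> ab cv cw dv dw.
apply: (dissipative_decay dotH (w := fun t => v t - w t) ab).
  by move=> t; exact: cvgB (cv t) (cw t).
move=> t tab; exists (G (v t) - G (w t)).
  exact: is_deriveB (dv t tab) (dw t tab).
exact: regularized_dissipative.
Qed.

Section Solution.
Variables (u0 : H) (u : R -> H).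
Hypothesis solu : solves_cauchy G u0 u.

Let du (t : R) : 0 < t -> is_derive t (1 : R) u (G (u t)).
Proof. by case: solu => _ _; apply. Qed.

(** The equation is autonomous, so a time translate of a solution solves it. *)
Lemma solution_translate (a b h : R) : 0 < a -> a <= b -> 0 < a + h ->
  `|u (h + b) - u b| <= expR (- eps * (b - a)) * `|u (h + a) - u a|.
Proof.
move=> a0 ab ah.
have dsh (t : R) : t \in `[a, b] ->
    is_derive t (1 : R) (fun s => u (h + s)) (G (u (h + t))).
  rewrite in_itv/= => /andP[at_ _].
  have /du/is_derive_cvg : 0 < h + t by rewrite addrC (lt_le_trans ah)// lerD2r.
  by move=> cu; apply/is_derive_cvg; under eq_fun do rewrite addrCA.
have dst (t : R) : t \in `[a, b] -> is_derive t (1 : R) u (G (u t)).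
  by rewrite in_itv/= => /andP[at_ _]; apply: du; exact: lt_le_trans at_.
have ch : {within `[a, b], continuous (fun s => u (h + s))}.
  by apply: derivable_within_continuous => t /dsh[].
have cu : {within `[a, b], continuous u}.
  by apply: derivable_within_continuous => t /dst[].
have /= contr := @flow_contraction (fun s => u (h + s)) u a b ab.
apply (contr ch cu) => t tab.
- by apply: dsh; exact: subset_itv_oo_cc tab.
- by apply: dst; exact: subset_itv_oo_cc tab.
Qed.

(** Divide the contraction estimate for translates by h and let h tend to 0. *)
Lemma velocity_decay (a b : R) : 0 < a -> a <= b ->
  `|G (u b)| <= expR (- eps * (b - a)) * `|G (u a)|.
Proof.
move=> a0 ab; have b0 := lt_le_trans a0 ab.
have cG (t : R) : 0 < t ->
    `|h^-1 *: (u (h + t) - u t)| @[h --> 0^'] --> `|G (u t)|.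
  by move=> t0; apply: cvg_norm; exact/is_derive_cvg/du.
have cGa : expR (- eps * (b - a)) * `|h^-1 *: (u (h + a) - u a)|
    @[h --> 0^'] --> expR (- eps * (b - a)) * `|G (u a)|.
  by apply: cvgM (cG _ a0); exact: cvg_cst.
have le_lim := ler_cvg_to (cG _ b0) cGa; apply: le_lim; near=> h.
rewrite !normrZ mulrCA ler_wpM2l//; apply: solution_translate => //.
have : `|h| < a by near: h; exact: dnbhs0_lt.
by rewrite ltr_norml => /andP[]; lra.
Unshelve. all: by end_near. Qed.

(** The increments u (n + 2) - u (n + 1) decay geometrically, so u (n + 1) has a
    limit; the velocity at time n + 1 tends to 0, so the limit is an
    equilibrium. *)
Lemma solution_equilibrium : continuous F -> exists V, F V + eps *: V = 0.
Proof.
move=> cF.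
(* Times start at 1 because the equation holds only at positive times. *)
pose x n := u n.+1%:R; pose q := expR (- eps).
have q0 : 0 <= q by exact: expR_ge0.
have q1 : `|q| < 1 by rewrite ger0_norm// expR_lt1 oppr_lt0.
have qn n : expR (- eps * (n.+1%:R - 1)) = q ^+ n.
  by rewrite -natr1 addrK mulrC expRM_natl.
have dx n : `|x n.+1 - x n| <= geometric `|u 2 - u 1| q n.
  have tr : `|u (1 + n.+1%:R) - u n.+1%:R| <= q ^+ n * `|u (1 + 1) - u 1|.
    by rewrite -qn; apply: solution_translate => //; rewrite ler1n.
  by rewrite /x /= mulrC -[n.+2%:R]nat1r.
have : cvgn (series (telescope x)).
  apply: normed_cvg; apply: (series_le_cvg _ _ dx) => [n|n|] /=.
  - exact: normr_ge0.
  - by rewrite mulr_ge0// exprn_ge0.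
  - exact: is_cvg_geometric_series.
move=> /cvg_ex[l xl].
have xV : x n @[n --> \oo] --> x 0%N + l.
  under eq_fun do rewrite eq_sum_telescope.
  by apply: cvgD => //; exact: cvg_cst.
set V := x 0%N + l in xV; exists V.
have GV : G (x n) @[n --> \oo] --> G V.
  apply: cvgB; first by apply: cvgN; apply: cvg_comp xV (cF V).
  by apply: cvgZr.
have G0 : G (x n) @[n --> \oo] --> (0 : H).
  apply/norm_cvg0P.
  apply: (@squeeze_cvgr _ _ _ _ (cst 0) (fun n => q ^+ n * `|G (u 1)|)).
  - near=> n; rewrite normr_ge0/= -qn; apply: velocity_decay => //.
    by rewrite ler1n.
  - exact: cvg_cst.
  - rewrite -[X in _ --> X](mul0r `|G (u 1)|); apply: cvgM; last exact: cvg_cst.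
    exact: cvg_expr.
have : G V = 0 by exact: cvg_unique GV G0.
by rewrite /G -opprD => /eqP; rewrite oppr_eq0 => /eqP.
Unshelve. all: by end_near. Qed.

(** An equilibrium is a constant solution. *)
Lemma solution_to_equilibrium (V : H) (t : R) : F V + eps *: V = 0 -> 0 <= t ->
  `|u t - V| <= expR (- (eps * t)) * `|u0 - V|.
Proof.
move=> FV t0; have [u00 cu _] := solu.
have GV : G V = 0 by rewrite /G -opprD FV oppr0.
rewrite -mulNr -u00.
have cut : {within `[0, t], continuous u}.
  apply: continuous_subspaceW cu => s /=; rewrite !in_itv/= andbT.
  by case/andP.
have cV : {within `[0, t], continuous (cst V)} by exact: cst_continuous.
have /= contr := @flow_contraction u (cst V) 0 t t0.
rewrite subr0 in contr; apply (contr cut cV) => s s0t.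
- by apply: du; move: s0t; rewrite in_itv/= => /andP[].
- by rewrite /= GV; exact: is_derive_cst.
Qed.

End Solution.
End FixedParameter.

(** * Convergence of the regularized zeros *)

(** Monotonicity gives (V, V - y) <= 0, that is |V|^2 <= (V, y). *)
Lemma regularized_norm_gap (eps : R) (V y : H) : 0 < eps ->
  F V + eps *: V = 0 -> F y = 0 -> `|V - y| ^+ 2 <= `|y| ^+ 2 - `|V| ^+ 2.
Proof.
move=> eps0 FV Fy; have := monoF V y.
have -> : F V - F y = (- eps) *: V.
  by rewrite Fy subr0 scaleNr; apply/eqP; rewrite -addr_eq0 FV.
rewrite linearZl_LR linearBr/= mulNr oppr_ge0 pmulr_rle0// dot_normsq//.
rewrite (normsqB dotH); lra.
Qed.

(** Monotonicity bounds e |V - W|^2 by (d - e) (W, V - W), so (W, V - W) >= 0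
    unless e = d, in which case V = W.  Now
    |V|^2 = |W|^2 + 2 (W, V - W) + |V - W|^2. *)
Lemma regularized_gap (e d : R) (V W : H) : 0 < e -> e <= d ->
  F V + e *: V = 0 -> F W + d *: W = 0 ->
  `|V - W| ^+ 2 <= `|V| ^+ 2 - `|W| ^+ 2.
Proof.
move=> e0 ed FV FW; have := monoF V W.
have -> : F V - F W = (d - e) *: W + (- e) *: (V - W).
  have -> : F V = - (e *: V) by apply/eqP; rewrite -addr_eq0 FV.
  have -> : F W = - (d *: W) by apply/eqP; rewrite -addr_eq0 FW.
  rewrite scalerBl scaleNr scalerBr opprK opprB addrC -addrA; congr (_ + _).
  by rewrite addrA addNr add0r.
rewrite linearDl !linearZl_LR/= dot_normsq// => mono.
have VWE : `|V| ^+ 2 = `|W| ^+ 2 + dot W (V - W) *+ 2 + `|V - W| ^+ 2.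
  by rewrite -(normsqD dotH) addrC subrK.
have := sqr_ge0 `|V - W|; have := sqr_ge0 (`|V| + `|W|).
move: ed; rewrite le_eqVlt => /predU1P[ed|]; last by nra.
have /eqP -> : V == W; last by rewrite subrr normr0 expr0n/= subrr.
rewrite -subr_eq0 -normr_eq0 -sqrf_eq0 eq_le sqr_ge0 andbT; nra.
Qed.

(** Along e = 1 / (n + 1) the norms increase and are bounded by |y|, so the gap
    estimate makes the zeros a Cauchy sequence.  Monotonicity of e |-> |V e| then
    carries the bound on |y|^2 - |V e|^2 from the sequence to all small e. *)
Lemma regularized_cvg (V : R -> H) (y : H) : continuous F ->
  (forall e : R, 0 < e -> F (V e) + e *: V e = 0) -> minimal_norm_zero F y ->
  `|V e - y| @[e --> 0^'+] --> (0 : R).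
Proof.
move=> cF FV [Fy ymin]; pose s n : R := n.+1%:R^-1; pose N n := `|V (s n)| ^+ 2.
have s0 n : 0 < s n by rewrite invr_gt0 ltr0n.
have gap_y (e : R) : 0 < e -> `|V e - y| ^+ 2 <= `|y| ^+ 2 - `|V e| ^+ 2.
  by move=> e0; exact: regularized_norm_gap e0 (FV _ e0) Fy.
have gap (e d : R) : 0 < e -> e <= d ->
    `|V e - V d| ^+ 2 <= `|V e| ^+ 2 - `|V d| ^+ 2.
  move=> e0 ed; have d0 := lt_le_trans e0 ed.
  exact: regularized_gap e0 ed (FV _ e0) (FV _ d0).
have s_le n m : (n <= m)%N -> s m <= s n.
  by move=> nm; rewrite lef_pV2 ?posrE ?ltr0n// ler_nat.
have gapN n m : (n <= m)%N -> `|V (s m) - V (s n)| ^+ 2 <= N m - N n.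
  by move=> nm; apply: gap => //; exact: s_le.
have N_le n : N n <= `|y| ^+ 2.
  by rewrite -subr_ge0; apply: le_trans (gap_y _ (s0 n)); exact: sqr_ge0.
have ndN : nondecreasing_seq N.
  move=> n m nm; rewrite -subr_ge0; apply: le_trans (gapN _ _ nm).
  exact: sqr_ge0.
have cN : cvgn N.
  apply: (nondecreasing_is_cvgn ndN).
  by exists (`|y| ^+ 2) => _ [n _ <-].
have [z Vz] : exists z : H, V (s n) @[n --> \oo] --> z.
  apply/cvg_ex/cauchy_cvgP; apply: cauchy_exP => e e0.
  have ltN : limn N - e ^+ 2 < limn N by rewrite ltrBlDr ltrDl exprn_gt0.
  have [n _ /(_ n (leqnn n)) /= Nn] := cvgr_gt _ cN _ ltN.
  exists (V (s n)); exists n => // m /= nm.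
  rewrite -ball_normE/= distrC -(@ltr_pXn2r _ 2) ?nnegrE// ?ltW//.
  apply: le_lt_trans (gapN _ _ nm) _.
  by have := nondecreasing_cvgn_le ndN cN m; lra.
have cs : s n @[n --> \oo] --> (0 : R) by exact: cvg_harmonic.
have Fz : F z = 0.
  have FVz : F (V (s n)) @[n --> \oo] --> F z by exact: cvg_comp Vz (cF z).
  have FV0 : F (V (s n)) @[n --> \oo] --> (0 : H).
    have -> : (fun n => F (V (s n))) = (fun n => - (s n *: V (s n))).
      by apply/funext => n; apply/eqP; rewrite -addr_eq0 FV.
    rewrite -oppr0 -(scale0r z); apply: cvgN; exact: cvgZ cs Vz.
  exact: cvg_unique FVz FV0.
have cNz : N n @[n --> \oo] --> `|z| ^+ 2.
  by rewrite expr2; apply: cvgM; exact: cvg_norm.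
have yz : `|y| ^+ 2 <= `|z| ^+ 2 by rewrite ler_pXn2r ?nnegrE// ymin.
apply/cvgrPdist_le => e e0.
have [n Nn] : exists n, `|y| ^+ 2 - e ^+ 2 <= N n.
  have lt_z : `|y| ^+ 2 - e ^+ 2 < `|z| ^+ 2.
    by rewrite (lt_le_trans _ yz)// ltrBlDr ltrDl exprn_gt0.
  by have [n _ /(_ n (leqnn n))] := cvgr_ge _ cNz _ lt_z; exists n.
near=> d; have d0 : 0 < d by near: d; exact: nbhs_right_gt.
have dn : d <= s n by near: d; exact: nbhs_right_le.
rewrite sub0r normrN normr_id -(@ler_pXn2r _ 2) ?nnegrE ?(ltW e0)//.
apply: le_trans (gap_y _ d0) _.
have := gap _ _ d0 dn; have := sqr_ge0 `|V d - V (s n)|; rewrite -/(N n); lra.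
Unshelve. all: by end_near. Qed.

End RegularizedFlow.

Theorem claim4p5 (R : realType) (H : completeNormedModType R)
  (dot : {dot H for idfun}) (dotH : induces_norm dot)
  (F : H -> H) (monoF : monotone_operator dot F)
  (u0 : H) (r : R) (r_gt0 : 0 < r)
  (dF : forall v : H, cball u0 r v -> differentiable F v)
  (D2F : H -> {bilinear H -> H -> H})
  (d2F : forall v : H, cball u0 r v -> is_diff2_within (cball u0 r) F v (D2F v))
  (M1 M2 : R)
  (M1P : (ereal_sup [set opnorm ('d F v) | v in cball u0 r] <= M1%:E)%E)
  (M2P : (ereal_sup [set opnorm2 (D2F v) | v in cball u0 r] <= M2%:E)%E)
  (lipF : locally_lipschitz F)
  (solvF : exists2 z : H, cball u0 r z & F z = 0)
  (y : H) (yP : minimal_norm_zero F y)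
  (u : R -> R -> H)
  (uP : forall eps : R, 0 < eps ->
    solves_cauchy (fun v : H => - F v - eps *: v) u0 (u eps))
  (t : R -> R) (t_gt0 : forall eps : R, 0 < eps -> 0 < t eps)
  (tP : eps * t eps @[eps --> 0^'+] --> +oo) :
  `|u eps (t eps) - y| @[eps --> 0^'+] --> (0 : R).
Proof.
have cF := locally_lipschitz_continuous lipF; have [Fy _] := yP.
have eqV (eps : R) : exists v, 0 < eps -> F v + eps *: v = 0.
  have [eps0|_] := ltP 0 eps; last by exists 0.
  have [v Fv] := solution_equilibrium dotH monoF eps0 (uP _ eps0) cF.
  by exists v.
have [V FV] := choice eqV.
have V_le (eps : R) : 0 < eps -> `|V eps| <= `|y|.
  move=> eps0; rewrite -(@ler_pXn2r _ 2) ?nnegrE// -subr_ge0.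
  apply: le_trans (regularized_norm_gap dotH monoF eps0 (FV _ eps0) Fy).
  exact: sqr_ge0.
have decay0 : expR (- (eps * t eps)) @[eps --> 0^'+] --> (0 : R).
  exact: (cvg_comp _ _ tP (@cvgr_expR R)).
have major0 : expR (- (eps * t eps)) * (`|u0| + `|y|) + `|V eps - y|
    @[eps --> 0^'+] --> 0 * (`|u0| + `|y|) + 0.
  apply: cvgD; last exact: (regularized_cvg dotH monoF cF FV yP).
  by apply: cvgM decay0 _; exact: cvg_cst.
rewrite mul0r addr0 in major0.
apply: (squeeze_cvgr _ (cvg_cst 0) major0); near=> eps.
have eps0 : 0 < eps by near: eps; exact: nbhs_right_gt.
rewrite normr_ge0/= (le_trans (ler_distD (V eps) _ _))// lerD2r.
have t0 := ltW (t_gt0 _ eps0).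
have toV := solution_to_equilibrium dotH monoF (uP _ eps0) (FV _ eps0) t0.
apply: le_trans toV _.
rewrite ler_wpM2l ?expR_ge0// (le_trans (ler_normB _ _))// lerD2l.
exact: V_le.
Unshelve. all: by end_near. Qed.
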